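(* Let $X$ be a continuum and let $Y\in C(X)$ be a neighborhood retract of $X$. If $X$ is Kelley, then $Y$ is Kelley; and if $X$ is semi-Kelley, then $Y$ is semi-Kelley.
   Context: A continuum is a compact connected metric space with more than one point. A subcontinuum of a continuum $X$ is a non-empty compact connected subset of $X$ (one-point sets are allowed). $C(X)$ denotes the hyperspace of all subcontinua of $X$ with the Hausdorff metric; convergence of subcontinua is with respect to this metric. A subcontinuum $Y$ of $X$ is a neighborhood retract of $X$ if there exist an open set $U$ of $X$ with $Y\subset U$ and a retraction $r:U\to Y$ (a continuous map with $r(y)=y$ for all $y\in Y$). A continuum $X$ is Kelley at a point $p\in X$ if for each subcontinuum $K$ of $X$ containing $p$ and each sequence $\{p_n\}_{n=1}^\infty$ in $X$ converging to $p$, there exists a sequence $\{K_n\}_{n=1}^\infty$ of subcontinua of $X$ converging to $K$ such that $p_n\in K_n$ for every $n\in\mathbb N$. A continuum is Kelley if it is Kelley at each of its points. Let $K$ be a subcontinuum of $X$. A maximal limit continuum of $K$ is a subcontinuum $M\subset K$ for which there is a sequence $\{M_n\}_{n=1}^\infty$ of subcontinua of $X$ converging to $M$ such that for each convergent sequence $\{M_n'\}_{n=1}^\infty$ of subcontinua of $X$ with $M_n\subset M_n'$ for each $n\in\mathbb N$ and $\lim M_n'=M'\subset K$, we have $M'=M$. A continuum $X$ is semi-Kelley if for each subcontinuum $K$ of $X$ and every two maximal limit continua $L$ and $M$ of $K$, either $L\subset M$ or $M\subset L$. The Kelley and semi-Kelley definitions are applied verbatim to one-point spaces, which satisfy both trivially.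 *)

(* Defs.v *)
From HB Require Import structures.
From mathcomp Require Import all_boot all_order all_algebra.
From mathcomp Require Import all_classical all_reals all_analysis.

Set Implicit Arguments.
Unset Strict Implicit.
Unset Printing Implicit Defensive.

Import Order.TTheory GRing.Theory Num.Theory.
Import numFieldNormedType.Exports.

Local Open Scope classical_set_scope.
Local Open Scope ring_scope.

(* The library makes [set_type A] a pseudometric space for A : set X; this adds
   the restricted distance, so that a subset of a metric space is itself a
   [metricType]. *)
Section set_type_metric.
Context {R : realType} {X : metricType R} (A : set X).

Let dist (x y : set_type A) : R := mdist (set_val x) (set_val y).

Let dist_ge0 x y : 0 <= dist x y.
Proof. exact: mdist_ge0. Qed.

Let dist_positivity x y : dist x y = 0 -> x = y.
Proof. by move=> /mdist_positivity/val_inj. Qed.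

Let ballE_dist (x : set_type A) d : ball x d = [set y | dist x y < d].
Proof.
apply/seteqP; split=> y.
  by move=> xy; have : ball (set_val x) d (set_val y) by []; rewrite ballEmdist.
by move=> xy; suff : ball (set_val x) d (set_val y) by []; rewrite ballEmdist.
Qed.

HB.instance Definition _ :=
  @PseudoMetric_isMetric.Build R (set_type A) dist
    dist_ge0 dist_positivity ballE_dist.

End set_type_metric.

Section continua.
Context {R : realType}.
Implicit Type X : metricType R.

Definition continuum X :=
  [/\ compact [set: X], connected [set: X] & exists x y : X, x <> y].

Definition subcontinuum X (K : set X) :=
  [/\ K !=set0, compact K & connected K].

Definition nbhd_of X (e : R) (A : set X) : set X :=
  [set x | exists2 a, A a & mdist x a < e].

(* Only meaningful on nonempty bounded sets, where the set of admissible radii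
   is nonempty; it is used below on subcontinua only. *)
Definition hausdorff_dist X (A B : set X) : R :=
  inf [set e | [/\ 0 < e, A `<=` nbhd_of e B & B `<=` nbhd_of e A]].

Definition hausdorff_cvg X (K_ : nat -> set X) (K : set X) :=
  hausdorff_dist (K_ n) K @[n --> \oo] --> (0 : R).

(* The values of r outside U are irrelevant. *)
Definition neighborhood_retract X (Y : set X) :=
  exists U : set X, [/\ open U, Y `<=` U &
    exists r : X -> X, [/\ {within U, continuous r},
      r @` U `<=` Y & forall y, Y y -> r y = y]].

Definition kelley_at X (p : X) :=
  forall K : set X, subcontinuum K -> K p ->
  forall p_ : nat -> X, p_ n @[n --> \oo] --> p ->
  exists K_ : nat -> set X, [/\ forall n, subcontinuum (K_ n),
    hausdorff_cvg K_ K & forall n, K_ n (p_ n)].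

Definition kelley X := forall p : X, kelley_at p.

Definition maximal_limit_continuum X (K M : set X) :=
  [/\ subcontinuum M, M `<=` K &
    exists M_ : nat -> set X, [/\ forall n, subcontinuum (M_ n),
      hausdorff_cvg M_ M &
      forall (M'_ : nat -> set X) (M' : set X),
        (forall n, subcontinuum (M'_ n)) -> (forall n, M_ n `<=` M'_ n) ->
        subcontinuum M' -> hausdorff_cvg M'_ M' -> M' `<=` K -> M' = M]].

Definition semi_kelley X :=
  forall K : set X, subcontinuum K ->
  forall L M : set X,
    maximal_limit_continuum K L -> maximal_limit_continuum K M ->
    L `<=` M \/ M `<=` L.

End continua.

(* Main.v *)
(** Subcontinua of [Y] are subcontinua of [X], and [X]-subcontinua converging
    to a subcontinuum [K] of [Y] eventually lie in the open set [U] on which the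
    retraction [r] is defined, where [r] turns them into subcontinua of [Y]
    still converging to [r(K) = K]; the finitely many others can be replaced
    arbitrarily.  This gives the Kelley property directly.  It also shows that
    a maximal limit continuum of [K] in [Y], witnessed by [M_n], is one in [X]
    with the same witness: if [M_n `<=` M'_n] and [M'_n] tends to
    [M' `<=` K], then the continua [r(M'_n)] contain [r(M_n) = M_n] and tend to
    [M']. *)
Require Import Defs.
From mathcomp Require Import all_boot all_order all_algebra.
From mathcomp Require Import all_classical all_reals all_analysis.

Set Implicit Arguments.
Unset Strict Implicit.
Unset Printing Implicit Defensive.

Import Order.TTheory GRing.Theory Num.Theory.
Import numFieldNormedType.Exports.

Local Open Scope classical_set_scope.
Local Open Scope ring_scope.

Module Metric := metricType_numDomainType.

Section hausdorff.
Context {R : realType} {X : metricType R}.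
Implicit Types (A B K : set X) (e : R).

(** Compactness, in its near-covering form, gives one radius around [x0] that works for all points;
    the triangle inequality through [x0] doubles it. *)
Lemma compact_mdist_bounded :
  compact [set: X] -> exists b : R, forall x y : X, mdist x y <= b.
Proof.
move=> cX; have [[x0]|nX] := pselect ([set: X] !=set0); last first.
  by exists 0 => x; case: nX; exists x.
move=> _; have /compact_near_coveringP nc := cX.
have : \forall b \near +oo, [set: X] `<=` (fun y => mdist x0 y < b).
  apply: (nc R +oo (fun b y => mdist x0 y < b)) => x _.
  exists (ball x 1, [set b | mdist x0 x + 1 < b]).
    by split; [exact: nbhsx_ballx|apply: nbhs_pinfty_gt; rewrite num_real].
  move=> [y b] /= []; rewrite ballEmdist/= => xy; apply: lt_trans.
  by rewrite (le_lt_trans (metric_triangle x0 x y))// ltrD2l.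
move=> [b [_ /(_ (b + 1))]]; rewrite ltrDl ltr01 => /(_ isT) x0b.
exists ((b + 1) + (b + 1)) => x y; rewrite (le_trans (metric_triangle x x0 y))//.
by rewrite (metric_sym x) lerD// ltW// x0b.
Qed.

Lemma subset_nbhd_of e e' A : e <= e' -> nbhd_of e A `<=` nbhd_of e' A.
Proof. by move=> ee' x [a Aa xa]; exists a => //; exact: lt_le_trans ee'. Qed.

Lemma hausdorff_dist_ge0 A B : 0 <= hausdorff_dist A B.
Proof.
rewrite /hausdorff_dist; set E := [set e | _].
have [E0|/set0P/negP/negPn/eqP ->] := pselect (E !=set0); last by rewrite inf0.
by apply: lb_le_inf => // e [/ltW].
Qed.

Lemma hausdorff_dist_le e A B : 0 < e ->
  A `<=` nbhd_of e B -> B `<=` nbhd_of e A -> hausdorff_dist A B <= e.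
Proof. by move=> e0 AB BA; apply: ge_inf => //; exists 0 => d [/ltW]. Qed.

(* Boundedness of the metric is what makes the set of admissible radii
   nonempty; otherwise its infimum would be the junk value 0. *)
Lemma hausdorff_dist_lt (b e : R) A B : (forall x y : X, mdist x y <= b) ->
  A !=set0 -> B !=set0 -> hausdorff_dist A B < e ->
  A `<=` nbhd_of e B /\ B `<=` nbhd_of e A.
Proof.
move=> Xb [a Aa] [c Bc] /inf_lt[].
  have b1 : b < b + 1 by rewrite ltrDl.
  exists (b + 1); split; first by rewrite (le_lt_trans _ b1)// -(mdistxx a).
    by move=> x _; exists c => //; exact: le_lt_trans b1.
  by move=> x _; exists a => //; exact: le_lt_trans b1.
by move=> d [_ AB BA] /ltW/subset_nbhd_of de; split=> x => [/AB|/BA]; exact: de.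
Qed.

(** Trades the infimum for inclusions in neighborhoods, the form in which convergence can be pushed
    through [r]. *)
Lemma hausdorff_cvgP (b : R) (K_ : nat -> set X) K :
  (forall x y : X, mdist x y <= b) -> (forall n, K_ n !=set0) -> K !=set0 ->
  hausdorff_cvg K_ K <-> (forall e, 0 < e ->
    \forall n \near \oo, K_ n `<=` nbhd_of e K /\ K `<=` nbhd_of e (K_ n)).
Proof.
move=> Xb K_0 K0; split=> [/cvgrPdist_lt cK e e0|cK].
  near=> n; apply: (hausdorff_dist_lt Xb) => //.
  rewrite (le_lt_trans (ler_norm _))// -normrN -sub0r.
  by near: n; exact: cK.
apply/cvgrPdist_le => e e0; near=> n.
rewrite sub0r normrN ger0_norm ?hausdorff_dist_ge0//.
have [] : K_ n `<=` nbhd_of e K /\ K `<=` nbhd_of e (K_ n).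
  by near: n; exact: cK.
exact: hausdorff_dist_le.
Unshelve. all: by end_near. Qed.

(** Uniform continuity around a compact set: [y] need not lie in [K], so the same [d] also keeps the
    [d]-neighborhood of [K] inside [U]. *)
Lemma within_continuous_mdist (Z : metricType R) (U K : set X) (r : X -> Z) e :
  open U -> {within U, continuous r} -> compact K -> K `<=` U -> 0 < e ->
  exists2 d, 0 < d & forall x y, K x -> mdist x y < d ->
    U y /\ mdist (r x) (r y) < e.
Proof.
move=> oU + cK KU e0; rewrite continuous_open_subspace// => rU.
have /compact_near_coveringP nc := cK.
have : \forall d \near 0^'+, K `<=` (fun x => forall y, mdist x y < d ->
    U y /\ mdist (r x) (r y) < e).
  apply: (nc R 0^'+ (fun d x => forall y, mdist x y < d ->
    U y /\ mdist (r x) (r y) < e)) => x Kx.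
  have /Metric.nbhs_mdistP[d /= d0 xd] :
      \forall y \near x, U y /\ mdist (r x) (r y) < e / 2.
    near=> y; split; near: y; first exact/open_nbhs_nbhs/(conj oU)/KU.
    by apply: Metric.cvgr_dist_lt; [apply: rU; exact/mem_set/KU|rewrite divr_gt0].
  (* With both radii halved, [x'] and [y] stay within [d] of [x], so [r x'] and [r y] are each
     within [e / 2] of [r x]. *)
  exists (ball x (d / 2), [set t | t < d / 2]).
    by split; [apply: nbhsx_ballx|apply: nbhs_right_lt]; rewrite divr_gt0.
  move=> [x' t] /= []; rewrite ballEmdist/= => xx' td y x'y.
  have [] : U x' /\ mdist (r x) (r x') < e / 2.
    by apply: xd => /=; rewrite (lt_trans xx')// gtr_pMr// invf_lt1// ltr1n.
  move=> _ rx'; have [|Uy ry] := xd y.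
    rewrite /= (le_lt_trans (metric_triangle x x' y))// [ltRHS]splitr ltrD//.
    exact: lt_trans td.
  split=> //; rewrite (le_lt_trans (metric_triangle _ (r x) _))//.
  by rewrite [ltRHS]splitr ltrD// metric_sym.
move=> Kd; have [d [Kd' d0]] := filter_ex (filterI Kd (nbhs_right_gt (0 : R))).
by exists d => // x y /Kd'; exact.
Unshelve. all: by end_near. Qed.

Lemma subcontinuum_image (Z : metricType R) (f : X -> Z) K :
  {within K, continuous f} -> subcontinuum K -> subcontinuum (f @` K).
Proof.
move=> fK [[x Kx] cK coK]; split; first by exists (f x), x.
- exact: continuous_compact.
- exact: connected_continuous_connected.
Qed.

Lemma subcontinuum1 (x : X) : subcontinuum [set x].
Proof. by split; [exists x|exact: compact_set1|exact: connected1]. Qed.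

End hausdorff.

(** * Transfer along an isometric embedding [i] with a left inverse [r] continuous on [U] *)

Section retract.
Context {R : realType} {X Z : metricType R}.
Variables (i : Z -> X) (r : X -> Z) (U : set X).
Hypothesis iE : forall x y, mdist (i x) (i y) = mdist x y.
Hypothesis ir : cancel i r.
Hypothesis oU : open U.
Hypothesis iU : forall z, U (i z).
Hypothesis rU : {within U, continuous r}.
Hypothesis cX : compact [set: X].
Implicit Types (K : set Z) (A : set X).

Let continuous_i : continuous i.
Proof.
move=> z; apply/Metric.cvgrPdist_lt => e e0; near=> y; rewrite iE; near: y.
by apply: Metric.cvgr_dist_lt.
Unshelve. all: by end_near. Qed.

Lemma nbhd_of_isometry (e : R) K L :
  (i @` K `<=` nbhd_of e (i @` L)) = (K `<=` nbhd_of e L).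
Proof.
rewrite propeqE; split=> [KL x Kx|KL _ [x Kx <-]].
  by have [|_ [y Ly <-]] := KL (i x); [exists x|rewrite iE; exists y].
by have [y Ly xy] := KL x Kx; exists (i y); [exists y|rewrite iE].
Qed.

Lemma hausdorff_dist_isometry K L :
  hausdorff_dist (i @` K) (i @` L) = hausdorff_dist K L.
Proof. by congr inf; apply/funext => e /=; rewrite !nbhd_of_isometry. Qed.

Lemma hausdorff_cvg_isometry (K_ : nat -> set Z) K :
  hausdorff_cvg K_ K -> hausdorff_cvg (fun n => i @` K_ n) (i @` K).
Proof.
by apply: cvg_trans; under eq_cvg do rewrite hausdorff_dist_isometry.
Qed.

Lemma subcontinuum_isometry K : subcontinuum K -> subcontinuum (i @` K).
Proof. by apply: subcontinuum_image; exact: continuous_subspaceT. Qed.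

Lemma retract_isometryK K : r @` (i @` K) = K.
Proof.
apply/seteqP; split=> [_ [_ [z Kz <-] <-]|z Kz]; first by rewrite ir.
by exists (i z); [exists z|].
Qed.

Lemma isometry_retractK A K : A `<=` i @` K -> i @` (r @` A) = A.
Proof.
move=> AK; apply/seteqP; split=> [_ [_ [x Ax <-] <-]|x Ax].
  by have [z _ zx] := AK x Ax; rewrite -zx ir zx.
have [z _ zx] := AK x Ax; exists z => //.
by exists x; rewrite // -zx ir.
Qed.

(** Continuity of [r] is known only on [U], so the fallback [K] makes every term of a sequence a
    subcontinuum. *)
Definition retract_or A K : set Z := if `[< A `<=` U >] then r @` A else K.

Lemma subcontinuum_retract_or A K :
  subcontinuum A -> subcontinuum K -> subcontinuum (retract_or A K).
Proof.
rewrite /retract_or; case: asboolP => // AU cA _.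
by apply: subcontinuum_image => //; exact: continuous_subspaceW rU.
Qed.

Lemma subset_retract_or A K : i @` K `<=` A -> K `<=` retract_or A K.
Proof.
rewrite /retract_or; case: asboolP => [_ KA z Kz|_ _]; last exact: subset_refl.
by exists (i z) => //; apply: KA; exists z.
Qed.

Lemma hausdorff_cvg_retract_or (A_ : nat -> set X) (D_ : nat -> set Z) K :
  (forall n, subcontinuum (A_ n)) -> (forall n, subcontinuum (D_ n)) ->
  subcontinuum K -> hausdorff_cvg A_ (i @` K) ->
  hausdorff_cvg (fun n => retract_or (A_ n) (D_ n)) K.
Proof.
move=> cA cD cK; have [b Xb] := compact_mdist_bounded cX.
have Zb (x y : Z) : mdist x y <= b by rewrite -iE.
have ciK := subcontinuum_isometry cK.
move=> /(hausdorff_cvgP Xb) AK; apply/(hausdorff_cvgP Zb).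
- by move=> n; have [] := subcontinuum_retract_or (cA n) (cD n).
- by case: cK.
move=> e e0; have [||d d0 rd] :=
  within_continuous_mdist (K := i @` K) oU rU _ _ e0.
- by case: ciK.
- by move=> _ [z _ <-].
near=> n; have [AnK KAn] :
    A_ n `<=` nbhd_of d (i @` K) /\ i @` K `<=` nbhd_of d (A_ n).
  near: n; apply: AK => //; last by case: ciK.
  by move=> n; case: (cA n).
rewrite /retract_or asboolT; last first.
  by move=> x /AnK[y Ky]; rewrite metric_sym => /(rd y x Ky)[].
split=> [_ [x /AnK[_ [z Kz <-]] + <-]|z Kz].
  rewrite metric_sym => /rd[|_]; first by exists z.
  by rewrite ir metric_sym => ?; exists z.
have iKz : (i @` K) (i z) by exists z.
by have [x Ax /(rd _ _ iKz)[_]] := KAn _ iKz; rewrite ir; exists (r x) => //; exists x.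
Unshelve. all: by end_near. Qed.

Lemma kelley_retract : kelley X -> kelley Z.
Proof.
move=> kX p K cK Kp p_ pp.
have [||A_ [cA AK Ap]] := kX (i p) _ (subcontinuum_isometry cK) _ (i \o p_).
- by exists p.
- by apply: continuous_cvg pp; exact: continuous_i.
(* The fallback is chosen so that [p_ n] belongs to the term in either case. *)
exists (fun n => retract_or (A_ n) [set p_ n]); split.
- by move=> n; apply: subcontinuum_retract_or => //; exact: subcontinuum1.
- by apply: hausdorff_cvg_retract_or => // n; exact: subcontinuum1.
- move=> n; apply: (@subset_retract_or _ [set p_ n]) => //.
  by move=> _ [_ -> <-]; exact: Ap.
Qed.

Lemma maximal_limit_continuum_isometry K M :
  maximal_limit_continuum K M -> maximal_limit_continuum (i @` K) (i @` M).
Proof.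
move=> [cM MK [M_ [cM_ M_M maxM]]]; split.
- exact: subcontinuum_isometry.
- exact: image_subset.
exists (fun n => i @` M_ n); split.
- by move=> n; exact: subcontinuum_isometry.
- exact: hausdorff_cvg_isometry.
move=> A_ A cA_ MA cA A_A AK; have iA := isometry_retractK AK.
have crA : subcontinuum (r @` A).
  apply: subcontinuum_image => //; apply: continuous_subspaceW rU.
  by move=> _ /AK[z _ <-].
rewrite -iA; congr image.
(* The fallback [M_ n] keeps the competitor above [M_ n] even when [A_ n] leaves [U]. *)
apply: (maxM (fun n => retract_or (A_ n) (M_ n))) => //.
- by move=> n; exact: subcontinuum_retract_or.
- by move=> n; exact: subset_retract_or.
- by apply: hausdorff_cvg_retract_or => //; rewrite iA.
- by rewrite -(retract_isometryK K); exact: image_subset.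
Qed.

Lemma semi_kelley_retract : semi_kelley X -> semi_kelley Z.
Proof.
move=> sX K cK L M /maximal_limit_continuum_isometry mL.
move=> /maximal_limit_continuum_isometry mM.
rewrite -(retract_isometryK L) -(retract_isometryK M).
by case: (sX _ (subcontinuum_isometry cK) _ _ mL mM) => ?;
  [left|right]; exact: image_subset.
Qed.

End retract.

Theorem theorem3p1 (R : realType) (X : metricType R) (Y : set X)
    (hX : continuum X) (hY : subcontinuum Y) (hr : neighborhood_retract Y) :
  (kelley X -> kelley (set_type Y)) /\
  (semi_kelley X -> semi_kelley (set_type Y)).
Proof.
have [cX _ _] := hX; have [[y0 Yy0] _ _] := hY.
have [U [oU YU [r [rU rUY rY]]]] := hr.
(* Outside [U] the values of [r] may leave [Y]; they are sent to [y0]. *)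
pose r' x : set_type Y := insubd (exist _ y0 (mem_set Yy0)) (r x).
have r'E x : U x -> set_val (r' x) = r x.
  by move=> Ux; rewrite set_valE /= insubdK//; apply/mem_set/rUY; exists x.
have r'K : cancel set_val r'.
  move=> y; apply: val_inj; have Yy : Y (set_val y) by exact: set_valP.
  by have := r'E _ (YU _ Yy); rewrite rY.
(* As [U] is open, points near [x] stay in [U], where [r'] agrees with [r] and distances in [Y] are
   those of [X]. *)
have r'U : {within U, continuous r'}.
  move: rU; rewrite !continuous_open_subspace// => rU x xU.
  apply/Metric.cvgrPdist_lt => e e0; have Ux := set_mem xU; near=> y.
  have Uy : U y by near: y; exact: open_nbhs_nbhs.
  suff : mdist (r x) (r y) < e by rewrite -r'E// -r'E.
  by near: y; apply: Metric.cvgr_dist_lt => //; exact: rU.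
have valE (x y : set_type Y) : mdist (set_val x) (set_val y) = mdist x y by [].
have YUv (y : set_type Y) : U (set_val y) by exact/YU/set_valP.
split.
- exact: kelley_retract valE r'K oU YUv r'U cX.
- exact: semi_kelley_retract valE r'K oU YUv r'U cX.
Unshelve. all: by end_near. Qed.
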